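(* Consider the Wigner ensemble of $n\times n$ real symmetric (or Hermitian) random matrices $A^{(n)}_{ij}=\frac{1}{\sqrt n}a_{ij}$, $i,j=1,\dots,n$, as described in the context, with $\mathbf{E}\,a_{ij}=0$ and $\mathbf{E}|a_{ij}|^2=v^2$. Let the probability distribution of the matrix elements $a_{ij}$ (in the Hermitian case, of their real and imaginary parts $b^{(1)}_{ij},b^{(2)}_{ij}$) have a symmetric density $f(x)=F'(x)$ of the form $$F'(x)=\begin{cases} C_\varphi\,|x|^{-13}\,\varphi(x), & |x|>1,\\ 0, & \text{otherwise,}\end{cases}$$ where $C_\varphi$ is the normalization constant and $\varphi$ is a bounded, even, positive function, monotone decreasing in $|x|$, such that $(\ln x)^{-1}\le \varphi(x)\le 1$ for all $x>x_0$, for some $x_0\ge 1$. Then for any choice of $\epsilon>0$ in $U_n=2n^{1/6+\epsilon}$, the high moments $\hat M^{(n)}_{2s}=\mathbf{E}\,\mathrm{Tr}\big(\hat A^{(n)}\big)^{2s}$ of the corresponding Wigner ensemble of matrices $\hat A^{(n)}$ truncated at level $U_n$ diverge; namely, $$\limsup_{n\to\infty}\ \frac{1}{(4v^2)^{s_n}}\,\hat M^{(n)}_{2s_n}=+\infty ,$$ where $s_n=\lfloor \vartheta n^{2/3}\rfloor$ with any $\vartheta>0$.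
   Context: Real symmetric case: $\{a_{ij},\,1\le i\le j\}$ are real jointly independent random variables with the same symmetric law, $\mathbf{E}a_{ij}=0$, $\mathbf{E}|a_{ij}|^2=v^2$, and $a_{ij}=a_{ji}$ for $i>j$. The truncated matrix has entries $\hat A^{(n)}_{ij}=\frac{1}{\sqrt n}\hat a^{(n)}_{ij}$, where $\hat a^{(n)}_{ij}=a_{ij}$ if $|a_{ij}|<U_n$ and $\hat a^{(n)}_{ij}=0$ if $|a_{ij}|\ge U_n$. Hermitian case: $a_{ij}=b^{(1)}_{ij}+\mathrm{i}\,b^{(2)}_{ij}$, where the $b^{(l)}_{ij}$, $l=1,2$, are i.i.d. real random variables with symmetric law such that $\mathbf{E}a_{ij}=0$ and $\mathbf{E}|a_{ij}|^2=v^2$, and $a_{ij}=\overline{a_{ji}}$ for $i>j$ (with real diagonal, as required for a Hermitian matrix). The truncation at level $U_n$ is applied in the same way to each of the variables $b^{(l)}_{ij}$, and $\hat A^{(n)}$ is formed from the truncated variables with the factor $\frac{1}{\sqrt n}$. $\mathbf{E}$ denotes expectation, $\mathrm{Tr}$ the unnormalized trace, and $\lfloor\cdot\rfloor$ the integer part. *)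

(* Defs.v *)
From HB Require Import structures.
From mathcomp Require Export all_boot all_order all_algebra.
From mathcomp Require Export complex.
From mathcomp Require Export all_classical all_reals all_analysis.
Export Order.TTheory GRing.Theory Num.Theory.
Export numFieldNormedType.Exports.

Set Implicit Arguments.
Unset Strict Implicit.
Unset Printing Implicit Defensive.

Local Open Scope classical_set_scope.
Local Open Scope ring_scope.

Section laws.
Context {R : realType} {d : measure_display} {T : measurableType d}.
Variable P : probability T R.

(* Product rule over every finite subfamily of (X i)_{i in D}. *)
Definition mutually_independent (I : choiceType) (D : set I)
    (X : I -> {RV P >-> R}) : Prop :=
  forall (J : seq I) (B : I -> set R),
    uniq J -> (forall i, i \in J -> D i) -> (forall i, measurable (B i)) ->
    P (\bigcap_(i in [set` J]) (X i @^-1` B i)) =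
    (\prod_(i <- J) P (X i @^-1` B i))%E.

Definition same_law (X Y : {RV P >-> R}) : Prop :=
  forall B : set R, measurable B -> distribution P X B = distribution P Y B.

Definition symmetric_law (X : {RV P >-> R}) : Prop :=
  forall B : set R, measurable B ->
    distribution P X B = distribution P X [set x | B (- x)].

Definition has_density (X : {RV P >-> R}) (f : R -> R) : Prop :=
  forall B : set R, measurable B ->
    distribution P X B = (\int[lebesgue_measure]_(x in B) (f x)%:E)%E.

End laws.

Section tail_density.
Context {R : realType}.
Implicit Type phi : R -> R.

Definition norm_const phi : R :=
  (\int[lebesgue_measure]_(x in [set x : R | 1 < `|x|])
     (`|x| ^- 13 * phi x))^-1.

Definition tail_density phi (x : R) : R :=
  if 1 < `|x| then norm_const phi * `|x| ^- 13 * phi x else 0.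

End tail_density.

Section truncation.
Context {R : realType}.

Definition truncate (U x : R) : R := if `|x| < U then x else 0.

Definition trunc_level (eps : R) (n : nat) : R :=
  2 * n%:R `^ (6^-1 + eps).

Definition moment_order (theta : R) (n : nat) : nat :=
  Num.truncn (theta * n%:R `^ (2 / 3)).

End truncation.

(* Indices are shifted: the entries 1 <= i <= j are numbered 0 <= i <= j. *)

Section real_symmetric.
Context {R : realType} {d : measure_display} {T : measurableType d}.
Variable P : probability T R.

Definition real_wigner_family (v : R) (a : nat -> nat -> {RV P >-> R}) : Prop :=
  [/\ mutually_independent [set p : nat * nat | (p.1 <= p.2)%N]
        (fun p => a p.1 p.2),
      forall i j, (i <= j)%N ->
        same_law (a i j) (a 0%N 0%N) /\ symmetric_law (a i j),
      forall i j, (i <= j)%N ->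
        ('E_P[a i j] = 0)%E /\ ('E_P[fun w => (`|a i j w| ^+ 2)%R] = (v ^+ 2)%:E)%E
    & forall i j, (j < i)%N -> forall w, a i j w = a j i w].

Definition real_trunc_mx (eps : R) (a : nat -> nat -> {RV P >-> R}) (n : nat)
    (w : T) : 'M[R]_n :=
  \matrix_(i, j) ((Num.sqrt n%:R)^-1 * truncate (trunc_level eps n) (a i j w)).

Definition real_trunc_moment eps a (n k : nat) : \bar R :=
  ('E_P[fun w => (\tr (real_trunc_mx eps a n w ^+ k))%R])%E.

End real_symmetric.

Section hermitian.
Context {R : realType} {d : measure_display} {T : measurableType d}.
Variable P : probability T R.
Local Open Scope complex_scope.

(* x false and x true are the arrays of real and imaginary parts; the diagonal
   is x false i i, and x true i i is never used. *)
Definition herm_entry (x : bool -> nat -> nat -> R) (i j : nat) : R[i] :=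
  if (i < j)%N then x false i j +i* x true i j
  else if i == j then (x false i i)%:C
  else conjc (x false j i +i* x true j i).

Definition herm_index : set (bool * nat * nat) :=
  [set p | (p.1.2 < p.2)%N \/ (p.1.1 = false /\ p.1.2 = p.2)].

(* The diagonal entry has the common law of the real and imaginary parts, hence
   second moment v ^+ 2 / 2: E|a_ij|^2 = v ^+ 2 is required off the diagonal. *)
Definition herm_wigner_family (v : R) (b : bool -> nat -> nat -> {RV P >-> R})
    : Prop :=
  [/\ mutually_independent herm_index (fun p => b p.1.1 p.1.2 p.2),
      forall l i j, herm_index (l, i, j) ->
        same_law (b l i j) (b false 0%N 0%N) /\ symmetric_law (b l i j),
      forall i j,
        ('E_P[fun w => complex.Re (herm_entry (fun l k m => b l k m w) i j)]
          = 0)%E /\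
        ('E_P[fun w => complex.Im (herm_entry (fun l k m => b l k m w) i j)]
          = 0)%E
    & forall i j, (i < j)%N ->
        ('E_P[fun w => (Normc.normc (herm_entry (fun l k m => b l k m w) i j) ^+ 2)%R]
          = (v ^+ 2)%:E)%E].

Definition herm_trunc_mx (eps : R) (b : bool -> nat -> nat -> {RV P >-> R})
    (n : nat) (w : T) : 'M[R[i]]_n :=
  \matrix_(i, j) (((Num.sqrt n%:R)^-1)%:C *
    herm_entry (fun l k m => truncate (trunc_level eps n) (b l k m w)) i j).

(* The trace of a power of a Hermitian matrix is real. *)
Definition herm_trunc_moment eps b (n k : nat) : \bar R :=
  ('E_P[fun w => complex.Re (\tr (herm_trunc_mx eps b n w ^+ k))%R])%E.

End hermitian.

Definition normalized_limsup {R : realType} (v : R) (M : nat -> nat -> \bar R)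
    (s : nat -> nat) : \bar R :=
  limn_esup (fun n => (((4 * v ^+ 2) ^+ s n)^-1%:E * M n (2 * s n)%N)%E).

(* Main.v *)
Require Import Defs.
From mathcomp Require Import ring lra zify measurable_realfun.

(* Any power [H ^+ (2 * s)] of a Hermitian matrix has trace at least the [s]-th
   power of the squared norm of a row of [H]. With [m = n `^ (6^-1 + eps)],
   about [8 v^2 n / m^2] entries of size at least [m] in the first row make the
   squared norm of that row of the rescaled matrix at least [8 v^2], twice the
   square of the edge [2 v] of the bulk. The tail of the density is heavy enough
   for each such entry to have probability at least a constant times [m ^- 13],
   so the event costs [exp (- O (n `^ (2/3 - 2 eps) ln n))], which is negligible
   against the gain [2 ^+ s_n = exp (c n `^ (2/3))]. *)

Set Implicit Arguments.
Unset Strict Implicit.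

Import HBNNSimple.
Local Open Scope classical_set_scope.
Local Open Scope ring_scope.

(** * Traces of even powers of a Hermitian matrix *)

(* With [t = b s.+1 / b s] the hypothesis is log-convexity of [b]; it is stated as
   a quadratic form because that is a diagonal entry of [(t H^s - H^(s+2))^2]. *)
Lemma quadratic_seq_ge (R : realFieldType) (b : nat -> R) :
  b 0%N = 1 -> (forall s, 0 <= b s) ->
  (forall t s, 0 <= t ^+ 2 * b s - 2 * t * b s.+1 + b s.+2) ->
  forall s, b 1%N ^+ s <= b s.
Proof.
move=> b0 b_ge0 bq s.
have [b1_gt0|] := ltP 0 (b 1%N); last first.
  move=> b1_le0; have -> : b 1%N = 0 by apply/le_anti; rewrite b1_le0 b_ge0.
  by case: s => [|s]; rewrite ?expr0 ?b0 // expr0n.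
(* Log-convexity makes the ratios [b s.+1 / b s] nondecreasing; the induction carries their lower
   bound [b 1], together with positivity of [b s]. *)
suff: (0 < b s) && (b 1%N * b s <= b s.+1) /\ b 1%N ^+ s <= b s by case.
elim: s => [|s [/andP[bs_gt0 bs_le] IH]]; first by rewrite b0 ltr01 mulr1 !lexx.
have bS_gt0 : 0 < b s.+1 by apply: lt_le_trans bs_le; rewrite mulr_gt0.
split; last first.
  by rewrite exprS; apply: le_trans bs_le; rewrite ler_pM2l.
rewrite bS_gt0 /=; have := bq (b s.+1 / b s) s.
have -> : (b s.+1 / b s) ^+ 2 * b s - 2 * (b s.+1 / b s) * b s.+1 + b s.+2
          = b s.+2 - b s.+1 / b s * b s.+1.
  by field; rewrite gt_eqF.
rewrite subr_ge0; apply: le_trans; rewrite ler_pM2r //.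
by rewrite ler_pdivlMr.
Qed.

Definition hermitian_mx (R : rcfType) n (H : 'M[R[i]]_n) : Prop :=
  H^T = map_mx conjc H.

Section hermitian_powers.
Context {R : rcfType} {n : nat}.
Implicit Types H K : 'M[R[i]]_n.

Lemma hermitian_mxX H k : hermitian_mx H -> hermitian_mx (H ^+ k).
Proof.
rewrite /hermitian_mx => hH.
elim: k => [|k IH]; first by rewrite !expr0 trmx1 map_mx1.
by rewrite [in LHS]exprSr [LHS]trmx_mul IH hH -map_mxM exprS.
Qed.

Lemma hermitian_sqr_diag H i : hermitian_mx H ->
  complex.Re ((H ^+ 2) i i) =
  \sum_j (complex.Re (H i j) ^+ 2 + complex.Im (H i j) ^+ 2).
Proof.
move=> hH; rewrite expr2 mxE raddf_sum; apply: eq_bigr => j _.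
have -> : H j i = conjc (H i j).
  by have /matrixP/(_ i j) := hH; rewrite !mxE.
by case: (H i j) => x y /=; ring.
Qed.

Lemma hermitian_sqr_diag_ge0 H i : hermitian_mx H ->
  0 <= complex.Re ((H ^+ 2) i i).
Proof.
move=> hH; rewrite hermitian_sqr_diag //.
by apply: sumr_ge0 => j _; rewrite addr_ge0 ?sqr_ge0.
Qed.

Lemma hermitian_even_diag_ge0 H s i : hermitian_mx H ->
  0 <= complex.Re ((H ^+ (2 * s)) i i).
Proof.
by move=> hH; rewrite mulnC exprM hermitian_sqr_diag_ge0//; exact: hermitian_mxX.
Qed.

(** Jensen's inequality for the spectral measure of [H ^+ 2] at the [i]-th basis vector, obtained
    without diagonalization: its moments satisfy [quadratic_seq_ge]. *)
Lemma hermitian_even_diag_ge H s i : hermitian_mx H ->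
  complex.Re ((H ^+ 2) i i) ^+ s <= complex.Re ((H ^+ (2 * s)) i i).
Proof.
move=> hH.
apply: (@quadratic_seq_ge _ (fun s => complex.Re ((H ^+ (2 * s)) i i))).
- by rewrite muln0 expr0 mxE eqxx.
- by move=> {}s; exact: hermitian_even_diag_ge0.
move=> t {}s; pose K := t%:C%C *: H ^+ s - H ^+ s.+2.
have hK : hermitian_mx K.
  rewrite /hermitian_mx /K linearB linearZ /= !hermitian_mxX//.
  by rewrite map_mxB map_mxZ /= /conjc oppr0.
have := @hermitian_sqr_diag_ge0 K i hK.
suff -> : K ^+ 2 = (t ^+ 2)%:C%C *: H ^+ (2 * s) - (2 * t)%:C%C *: H ^+ (2 * s.+1)
                   + H ^+ (2 * s.+2).
  have reZ (x : R) (z : R[i]) : complex.Re (x%:C%C * z) = x * complex.Re z.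
    by case: z => a b /=; ring.
  by rewrite !mxE !raddfD /= raddfN /= !reZ.
have HX p q r : (p + q = r)%N -> H ^+ p *m H ^+ q = H ^+ r.
  by move=> <-; rewrite exprD.
rewrite expr2 -[LHS]/(K *m K) /K mulmxBl !mulmxBr -!scalemxAl -!scalemxAr scalerA.
rewrite (HX s s (2 * s)%N); last by lia.
rewrite (HX s s.+2 (2 * s.+1)%N); last by lia.
rewrite (HX s.+2 s (2 * s.+1)%N); last by lia.
rewrite (HX s.+2 s.+2 (2 * s.+2)%N); last by lia.
rewrite -rmorphM -expr2 [(2 * t)%R]mulr_natl rmorphMn /=.
rewrite -scalerMnl mulr2n.
rewrite [- (_ - H ^+ _)]opprB opprD addrA.
by rewrite [LHS]addrAC [in RHS]addrA.
Qed.

(** The other diagonal entries of an even power are nonnegative, and dropping the imaginary parts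
    only lowers the row norm. Real parts alone suffice later. *)
Lemma hermitian_even_trace_ge H s i : hermitian_mx H ->
  (\sum_j complex.Re (H i j) ^+ 2) ^+ s <= complex.Re (\tr (H ^+ (2 * s))).
Proof.
move=> hH; rewrite raddf_sum [leRHS](bigD1 i) //=.
apply: ler_wpDr; first by apply: sumr_ge0 => j _; exact: hermitian_even_diag_ge0.
apply: le_trans (hermitian_even_diag_ge s i hH).
apply: lerXn2r; rewrite ?nnegrE ?hermitian_sqr_diag_ge0//.
  by apply: sumr_ge0 => j _; rewrite sqr_ge0.
rewrite hermitian_sqr_diag//; apply: ler_sum => j _.
by rewrite lerDl sqr_ge0.
Qed.

End hermitian_powers.

Lemma symmetric_even_trace_ge (R : rcfType) n (A : 'M[R]_n) s i : A^T = A ->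
  (\sum_j A i j ^+ 2) ^+ s <= \tr (A ^+ (2 * s)).
Proof.
move=> hA; pose H := map_mx (real_complex R) A.
have HX k : H ^+ k = map_mx (real_complex R) (A ^+ k).
  elim: k => [|k IH]; first by rewrite !expr0 map_mx1.
  by rewrite !exprS IH [RHS]map_mxM.
have hH : hermitian_mx H.
  rewrite /hermitian_mx /H map_trmx hA -map_mx_comp.
  by apply/matrixP => k l; rewrite !mxE /= oppr0.
have := hermitian_even_trace_ge s i hH.
rewrite HX trace_map_mx /=.
by under eq_bigr do rewrite mxE.
Qed.

(** * Lower bounds for integrals, probabilities and expectations *)

(** The integral is a supremum over simple functions below [f], and [c] times the indicator of [A]
    is one of them. This form also covers integrands whose measurability is not established, such as
    the density and the traces. *)
Lemma integral_ge_cst d (T : measurableType d) (R : realType)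
    (mu : {measure set T -> \bar R}) (A D : set T) (f : T -> \bar R) (c : R) :
  measurable A -> A `<=` D -> 0 <= c ->
  (forall x, D x -> 0 <= f x)%E -> (forall x, A x -> c%:E <= f x)%E ->
  (c%:E * mu A <= \int[mu]_(x in D) f x)%E.
Proof.
move=> mA AD c0 f0 cf.
have -> : (c%:E * mu A = \int[mu]_x (scale_nnsfun (indic_nnsfun R mA) c0 x)%:E)%E.
  under eq_integral do rewrite /= EFinM.
  rewrite ge0_integralZl_EFin//.
  - by rewrite integral_indic// setIT.
  - by move=> x _; rewrite lee_fin.
  - by apply/measurable_EFinP; exact: measurable_indic.
rewrite integralT_nnsfun ge0_integralE//.
apply: ereal_sup_ubound; exists (scale_nnsfun (indic_nnsfun R mA) c0) => // x /=.
rewrite /mindic /= indicE patchE.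
case: (boolP (x \in A)) => xA.
  rewrite mulr1 (mem_set (AD _ (set_mem xA))); exact/cf/set_mem.
by rewrite mulr0; case: ifPn => // /set_mem /f0.
Qed.

Section density.
Context {R : realType} {d : measure_display} {T : measurableType d}.
Variables (P : probability T R) (phi : R -> R).
Hypothesis phi_pos : forall x, 0 < phi x.
Hypothesis phi_decr : forall x y, `|x| <= `|y| -> phi y <= phi x.

Lemma norm_const_ge0 : 0 <= norm_const phi.
Proof.
rewrite invr_ge0; apply: Rintegral_ge0 => x _.
by rewrite mulr_ge0 ?(ltW (phi_pos _))// invr_ge0 exprn_ge0.
Qed.

Lemma tail_density_ge0 x : 0 <= tail_density phi x.
Proof.
rewrite /tail_density; case: ifP => // _.
by rewrite !mulr_ge0 ?norm_const_ge0 ?(ltW (phi_pos _))// invr_ge0 exprn_ge0.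
Qed.

(** A zero or infinite normalizing integral would give [norm_const phi] the default value 0; the
    density would then vanish and could not have total mass 1. *)
Lemma norm_const_gt0 (X : {RV P >-> R}) :
  has_density X (tail_density phi) -> 0 < norm_const phi.
Proof.
move=> /(_ setT measurableT); rewrite lt_neqAle norm_const_ge0 andbT eq_sym.
have -> : distribution P X setT = 1%E by exact: probability_setT.
case: eqP => // C0; rewrite integral0_eq.
  by move=> /eqP; rewrite eqe oner_eq0.
by move=> x _; rewrite /tail_density C0 !mul0r if_same.
Qed.

(** Both factors of the density decrease in [x], so on this interval of length [m] the density is at
    least its value at [2 * m]. *)
Lemma density_mass_ge (X : {RV P >-> R}) (m : R) :
  has_density X (tail_density phi) -> 1 < m ->
  ((norm_const phi * (2 * m) ^- 13 * phi (2 * m) * m)%:E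
    <= P (X @^-1` `[m, (2 * m)%R[%classic))%E.
Proof.
move=> hX m1; have m0 : 0 < m by apply: lt_trans m1.
have := hX `[m, (2 * m)%R[%classic (measurable_itv _).
rewrite /distribution /pushforward => ->.
rewrite EFinM.
have -> : (m%:E = lebesgue_measure (`[m, (2 * m)%R[%classic : set R))%E.
  rewrite lebesgue_measure_itv/= lte_fin ifT; last by lra.
  by rewrite -EFinB; congr EFin; ring.
apply: integral_ge_cst => //.
- rewrite !mulr_ge0 ?norm_const_ge0 ?(ltW (phi_pos _))//.
  by rewrite invr_ge0 exprn_ge0// mulr_ge0// ltW.
- by move=> x _; rewrite lee_fin tail_density_ge0.
move=> x; rewrite /= in_itv/= => /andP[mx x2m]; rewrite lee_fin /tail_density.
have x0 : 0 < x by apply: lt_le_trans mx.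
rewrite gtr0_norm// (lt_le_trans m1)//.
rewrite ler_pM ?mulr_ge0 ?norm_const_ge0 ?(ltW (phi_pos _))//.
- by rewrite invr_ge0 exprn_ge0// mulr_ge0// ltW.
- rewrite ler_wpM2l ?norm_const_ge0// lef_pV2 ?posrE ?exprn_gt0//; last by lra.
  by apply: lerXn2r; rewrite ?nnegrE; lra.
- by apply: phi_decr; rewrite !gtr0_norm//; lra.
Qed.

End density.

Section events.
Context {R : realType} {d : measure_display} {T : measurableType d}.
Variables (P : probability T R).

Lemma independent_event_ge (I : choiceType) (D : set I) (X : I -> {RV P >-> R})
    (B : set R) (q : R) (J : seq I) :
  mutually_independent D X -> measurable B -> 0 <= q -> uniq J ->
  (forall i, i \in J -> D i) ->
  (forall i, D i -> (q%:E <= P (X i @^-1` B))%E) ->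
  ((q ^+ size J)%:E <= P (\bigcap_(i in [set` J]) (X i @^-1` B)))%E.
Proof.
move=> indep mB q0 uJ JD qP; rewrite (indep J (fun=> B))//.
elim: J {uJ} JD => [|i J IH] JD; first by rewrite big_nil expr0.
rewrite big_cons /= exprS EFinM; apply: lee_pmul; rewrite ?lee_fin ?exprn_ge0//.
  by apply/qP/JD; rewrite mem_head.
by apply: IH => j jJ; apply: JD; rewrite in_cons jJ orbT.
Qed.

(** Markov's inequality, read as a lower bound on the expectation. *)
Lemma expectation_ge_event (Y : T -> R) (E : set T) (c q : R) :
  measurable E -> 0 <= c -> (forall w, 0 <= Y w) -> (forall w, E w -> c <= Y w) ->
  (q%:E <= P E)%E -> ((c * q)%:E <= 'E_P[Y])%E.
Proof.
move=> mE c0 Y0 cY qE; rewrite unlock EFinM.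
apply: (@le_trans _ _ (c%:E * P E)%E).
  by rewrite lee_wpmul2l ?lee_fin.
by apply: integral_ge_cst => // w *; rewrite lee_fin ?Y0 ?cY.
Qed.

End events.

(** * Growth rates: the cost of a heavy row against its gain *)

Section asymptotics.
Context {R : realType}.

Lemma near_natr_powR_ge (p A : R) : 0 < p -> \forall n \near \oo, A <= n%:R `^ p.
Proof.
move=> p0; near=> n.
have [A0|A0] := leP A 0; first by rewrite (le_trans A0)// powR_ge0.
have -> : A = (A `^ p^-1) `^ p by rewrite -powRrM mulVf ?gt_eqF// powRr1 ?ltW.
apply: ge0_ler_powR; rewrite ?nnegrE ?powR_ge0 ?ler0n ?(ltW p0)//.
by near: n; exact: nbhs_infty_ger.
Unshelve. all: by end_near. Qed.

(* The number of entries of size at least [m] in a row of the [n] x [n] matrix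
   that pushes its squared norm, after division by [n], above [2 * (4 * v ^+ 2)]. *)
Definition heavy_count (v m : R) (n : nat) : nat :=
  (Num.truncn (8 * v ^+ 2 * n%:R / m ^+ 2)).+1.

Lemma heavy_count_bounds (v m : R) n : 0 < m ->
  8 * v ^+ 2 * n%:R <= (heavy_count v m n)%:R * m ^+ 2 /\
  (heavy_count v m n)%:R <= 8 * v ^+ 2 * n%:R / m ^+ 2 + 1.
Proof.
move=> m0; set y := 8 * v ^+ 2 * n%:R / m ^+ 2.
have y0 : 0 <= y.
  by rewrite /y divr_ge0 ?sqr_ge0// mulr_ge0// mulr_ge0// sqr_ge0.
have /andP[l u] := truncn_itv y0.
rewrite -ler_pdivrMr ?exprn_gt0//; split.
  exact: (ltW u).
by rewrite -[heavy_count v m n]addn1 natrD lerD2r.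
Qed.

Variables (v c eps theta : R).
Hypotheses (c_gt0 : 0 < c) (eps_gt0 : 0 < eps) (theta_gt0 : 0 < theta).
Let m n : R := n%:R `^ (6^-1 + eps).
Let k n := heavy_count v (m n) n.

(** The heavy entries must fit into one row. Eventually [16 * v ^+ 2 <= m n ^+ 2], so the main term
    of the bound on [k n] is at most [n / 2], and so is the extra 1. *)
Lemma heavy_count_le : \forall n \near \oo, (k n <= n)%N.
Proof.
(* [lra] does not see section hypotheses. *)
have eps0 := eps_gt0.
near=> n.
have n1 : 1 <= n%:R :> R by near: n; exact: nbhs_infty_ger.
have n0 : 0 < n%:R :> R by lra.
have m0 : 0 < m n by rewrite powR_gt0.
have [_] := heavy_count_bounds v n m0; rewrite -/(k n) => kle.
rewrite -(ler_nat R); apply: le_trans kle _.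
have n2 : 2 <= n%:R :> R by near: n; exact: nbhs_infty_ger.
have n13 : 16 * v ^+ 2 <= n%:R `^ (1 / 3).
  by near: n; apply: near_natr_powR_ge; lra.
have m2 : n%:R `^ (1 / 3) <= m n ^+ 2.
  have al2 : 1 / 3 <= (6^-1 + eps) * 2 by lra.
  by rewrite -(powR_mulrn 2 (ltW m0)) /m -powRrM ler_powR.
rewrite -lerBrDr ler_pdivrMr ?exprn_gt0//.
have : 16 * v ^+ 2 * n%:R <= m n ^+ 2 * n%:R.
  by rewrite ler_pM2r// (le_trans n13).
have : 2 * m n ^+ 2 <= n%:R * m n ^+ 2 by rewrite ler_pM2r// exprn_gt0.
lra.
Unshelve. all: by end_near. Qed.

Lemma heavy_rows_dominate (A : R) :
  \forall n \near \oo,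
    A <= (c * m n ^- 13) ^+ k n * 2 ^+ moment_order theta n.
Proof.
(* Capping [eps] at 1/3 keeps the exponents [2 / 3 - 2 * dl] and [2 / 3 - dl] nonnegative, so these
   powers of [n] absorb additive constants. *)
have eps0 := eps_gt0; pose dl := Num.min eps 3^-1.
have dl0 : 0 < dl by rewrite lt_min eps_gt0 invr_gt0 ltr0n.
have dl1 : dl <= eps by rewrite ge_min lexx.
have dl2 : dl <= 3^-1 by rewrite ge_min lexx orbT.
pose al : R := 6^-1 + eps.
have al0 : 0 < al by rewrite /al; lra.
have ln20 : 0 < ln 2 :> R by rewrite ln_gt0 ?ltr1n.
(* [D] is chosen so that [- ln (c * m n ^- 13)], which equals [13 * al * ln n - ln c], is at most
   [D * N dl]. *)
pose D := 13 * al / dl + `|ln c|.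
have D0 : 0 < D by rewrite ltr_wpDr// divr_gt0// mulr_gt0.
have v8 : 0 <= 8 * v ^+ 2 by rewrite mulr_ge0// sqr_ge0.
pose D' := (8 * v ^+ 2 + 1) * D.
near=> n.
have n1 : 1 <= n%:R :> R by near: n; exact: nbhs_infty_ger.
have n0 : 0 < n%:R :> R by lra.
have m0 : 0 < m n by rewrite powR_gt0.
have [_ kle] := heavy_count_bounds v n m0; rewrite -/(k n) in kle.
pose N (x : R) := n%:R `^ x.
have N0 x : 0 < N x by rewrite powR_gt0.
have NM x y : N x * N y = N (x + y) by rewrite /N -powRD// (gt_eqF n0) /= implybT.
have leN x y : x <= y -> N x <= N y by move=> xy; rewrite ler_powR.
have N1 x : 0 <= x -> 1 <= N x by move=> x0; rewrite -(powRr0 n%:R) leN.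
(* At this threshold the gain exceeds the cost [D'], the loss [ln 2] from the integer part of [s_n],
   and the target [A]. *)
have Ndl : (D' + ln 2 + `|A|) / (theta * ln 2) <= N dl.
  by rewrite /N; near: n; exact: near_natr_powR_ge.
have q0 : 0 < c * m n ^- 13 by rewrite mulr_gt0// invr_gt0 exprn_gt0.
have lnn : ln n%:R <= N dl / dl.
  rewrite ler_pdivlMr// mulrC -ln_powR.
  exact/ltW/ln_sublinear/N0.
have lnq : - ln (c * m n ^- 13) <= D * N dl.
  rewrite lnM ?posrE ?invr_gt0 ?exprn_gt0// lnV ?posrE ?exprn_gt0// lnXn// ln_powR.
  rewrite -/al.
  have c1 : - ln c <= `|ln c| * N dl.
    apply: le_trans (ler_norm _) _; rewrite normrN ler_peMr// N1//; exact: ltW.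
  have : 13 * al * ln n%:R <= 13 * al * (N dl / dl) by rewrite ler_pM2l// mulr_gt0.
  rewrite /D mulrDl -mulr_natl; lra.
have kN : (k n)%:R <= (8 * v ^+ 2 + 1) * N (2 / 3 - 2 * dl).
  apply: le_trans kle _; rewrite [leRHS]mulrDl mul1r lerD//; last by apply: N1; lra.
  rewrite -mulrA ler_wpM2l//.
  have -> : m n ^+ 2 = N (2 * al) by rewrite -(powR_mulrn 2 (ltW m0)) /m -powRrM mulrC.
  have -> : n%:R = N 1 by rewrite /N powRr1 ?ltW.
  rewrite ler_pdivrMr// NM leN// /al; lra.
have kD : (k n)%:R * (- ln (c * m n ^- 13)) <= D' * N (2 / 3 - dl).
  have -> : N (2 / 3 - dl) = N (2 / 3 - 2 * dl) * N dl by rewrite NM; congr N; ring.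
  have -> : D' * (N (2 / 3 - 2 * dl) * N dl) =
            ((8 * v ^+ 2 + 1) * N (2 / 3 - 2 * dl)) * (D * N dl).
    by rewrite /D'; ring.
  apply: le_trans (ler_wpM2l _ lnq) _ => //.
  by rewrite ler_wpM2r// mulr_ge0// ltW.
have sn : theta * N (2 / 3) - 1 <= (moment_order theta n)%:R.
  have /truncn_itv/andP[_] : 0 <= theta * N (2 / 3) by rewrite mulr_ge0// ltW.
  rewrite -addn1 natrD /moment_order => /ltW; rewrite /N; lra.
have -> : (c * m n ^- 13) ^+ k n * 2 ^+ moment_order theta n =
  expR ((moment_order theta n)%:R * ln 2 - (k n)%:R * (- ln (c * m n ^- 13))).
  by rewrite mulrN opprK expRD !expRM_natl !lnK ?posrE// mulrC.
(* The exponent itself is eventually at least [A], so [1 + x <= expR x] is enough. *)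
apply: le_trans (expR_ge1Dx _).
have e1 := ler_wpM2r (ltW ln20) sn.
have e2 : D' + ln 2 + `|A| <= theta * ln 2 * N dl.
  by rewrite -ler_pdivrMl ?mulr_gt0// mulrC.
have e3 : theta * N (2 / 3) * ln 2 = theta * ln 2 * N dl * N (2 / 3 - dl).
  have -> : N (2 / 3) = N dl * N (2 / 3 - dl) by rewrite NM; congr N; ring.
  by ring.
have e4 : 1 <= N (2 / 3 - dl) by apply: N1; lra.
have e5 := ler_wpM2r (ltW (N0 (2 / 3 - dl))) e2.
have e6 : `|A| + ln 2 <= (`|A| + ln 2) * N (2 / 3 - dl).
  by rewrite ler_peMr// addr_ge0// ltW.
have := ler_norm A.
lra.
Unshelve. all: by end_near. Qed.

End asymptotics.

(** * Divergence from one row of independent heavy-tailed entries *)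

Section truncated_moments.
Context {R : realType} {d : measure_display} {T : measurableType d}.
Variables (P : probability T R) (phi : R -> R) (x0 : R).
Hypothesis phi_pos : forall x, 0 < phi x.
Hypothesis phi_decr : forall x y, `|x| <= `|y| -> phi y <= phi x.
Hypothesis phi_tail : forall x, x0 < x -> (ln x)^-1 <= phi x /\ phi x <= 1.

(** The crude bound [ln x <= x] gives [phi (2 * m) >= (2 * m)^-1]. The power of [m] lost is
    harmless, since only the logarithm of this probability matters. *)
Lemma density_mass_ge_powers (X : {RV P >-> R}) (m : R) :
  has_density X (tail_density phi) -> 1 < m -> x0 < 2 * m ->
  ((norm_const phi / 2 ^+ 14 * m ^- 13)%:E
    <= P (X @^-1` `[m, (2 * m)%R[%classic))%E.
Proof.
move=> hX m1 x0m; apply: le_trans (density_mass_ge phi_pos phi_decr hX m1).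
have m0 : 0 < m by lra.
have m2 : 1 < 2 * m by lra.
have phi_ge : (2 * m)^-1 <= phi (2 * m).
  apply: le_trans (proj1 (phi_tail x0m)).
  rewrite lef_pV2 ?posrE ?ln_gt0//; last by lra.
  by apply/ltW/ln_sublinear; lra.
rewrite lee_fin.
have -> : norm_const phi / 2 ^+ 14 * m ^- 13 =
          norm_const phi * (2 * m) ^- 13 * (2 * m)^-1 * m.
  by field; rewrite gt_eqF.
rewrite ler_pM2r// ler_wpM2l// mulr_ge0 ?(norm_const_ge0 phi_pos)//.
by rewrite invr_ge0 exprn_ge0//; lra.
Qed.

(** [X] falls in [[2, 4)] with positive probability, which forces a positive second moment. [Y]
    stands for the squared modulus of an entry containing [X]. *)
Lemma second_moment_neq0 (X : {RV P >-> R}) (Y : T -> R) (v : R) :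
  has_density X (tail_density phi) -> (forall w, X w ^+ 2 <= Y w) ->
  ('E_P[Y] = (v ^+ 2)%:E)%E -> v != 0.
Proof.
move=> hX XY EY.
have lt12 : (1 : R) < 2 by rewrite ltr1n.
have mass := density_mass_ge phi_pos phi_decr hX lt12.
set q := norm_const phi * _ * _ * _ in mass.
have q0 : 0 < q.
  by rewrite !mulr_gt0 ?(norm_const_gt0 phi_pos hX)// invr_gt0 exprn_gt0// mulr_gt0.
have : ((4 * q)%:E <= 'E_P[Y])%E.
  apply: expectation_ge_event mass => //.
  - by rewrite -[X in measurable X]setTI; exact: measurable_funP.
  - by move=> w; apply: le_trans (XY w); rewrite sqr_ge0.
  - move=> w /=; rewrite in_itv/= => /andP[Xw _]; apply: le_trans (XY w).
    have -> : 4 = 2 ^+ 2 :> R by ring.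
    by rewrite lerXn2r ?nnegrE//; lra.
rewrite EY lee_fin; apply: contraTneq => ->; rewrite expr0n/= -ltNge; lra.
Qed.

Variables (I : choiceType) (D : set I) (X : I -> {RV P >-> R}) (f : nat -> I).
Hypothesis indep : mutually_independent D X.
Hypothesis f_inj : injective f.
Hypothesis fD : forall j, D (f j).
Hypothesis dens : forall j, has_density (X (f j)) (tail_density phi).

(** Common core of both ensembles: [f] enumerates the first row, and [Y n s] is the trace of the
    power [2 * s], entering only through its lower bound by the row norm. *)
Lemma truncated_moments_diverge (v eps theta : R) (M : nat -> nat -> \bar R)
    (Y : nat -> nat -> T -> R) :
  v != 0 -> 0 < eps -> 0 < theta ->
  (forall n s, M n (2 * s)%N = ('E_P[Y n s])%E) ->
  (forall n s w, (0 < n)%N ->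
    (\sum_(j < n) ((Num.sqrt n%:R)^-1 *
       truncate (trunc_level eps n) (X (f j) w)) ^+ 2) ^+ s <= Y n s w) ->
  normalized_limsup v M (moment_order theta) = +oo%E.
Proof.
move=> v0 eps0 theta0 MY Yge.
have C0 := norm_const_gt0 phi_pos (dens 0).
pose c := norm_const phi / 2 ^+ 14.
have c0 : 0 < c by rewrite divr_gt0 ?exprn_gt0.
have v2 : 0 < v ^+ 2 by rewrite lt_neqAle sqr_ge0 andbT eq_sym sqrf_eq0.
rewrite /normalized_limsup.
(* The whole sequence is shown to tend to [+oo], which gives the upper limit. *)
apply: (cvg_limn_einf_sup _).2; apply/cvgeyPge => A.
have al0 : 0 < 6^-1 + eps by lra.
near=> n.
have n1 : 1 <= n%:R :> R by near: n; exact: nbhs_infty_ger.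
have n0 : (0 < n)%N by rewrite -(ltr_nat R); lra.
pose m : R := n%:R `^ (6^-1 + eps).
have mge : Num.max x0 2 <= m by rewrite /m; near: n; exact: near_natr_powR_ge.
have /andP[mx0 m2] : (x0 <= m) && (2 <= m) by rewrite -ge_max.
have m0 : 0 < m by lra.
have m1 : 1 < m by lra.
have x0m : x0 < 2 * m by lra.
set s := moment_order theta n.
pose k := heavy_count v m n.
have kn : (k <= n)%N by rewrite /k /m; near: n; exact: heavy_count_le.
have [kge _] := heavy_count_bounds v n m0; rewrite -/k in kge.
have Ale : A <= (c * m ^- 13) ^+ k * 2 ^+ s.
  by rewrite /k /s /m; near: n; exact: heavy_rows_dominate.
(* Otherwise [done] may try to compute [Num.truncn]. *)
clearbody k s.
(* Since [2 * m] is exactly the truncation level, entries in [B] survive truncation. *)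
pose B := `[m, (2 * m)%R[%classic : set R.
pose J := [seq f j | j <- iota 0 k].
pose E := \bigcap_(i in [set` J]) (X i @^-1` B).
have mB : measurable B by exact: measurable_itv.
have mE : measurable E.
  apply: fin_bigcap_measurable => // i _.
  by rewrite -[X in measurable X]setTI; exact: measurable_funP.
have PE : (((c * m ^- 13) ^+ k)%:E <= P E)%E.
  have -> : k = size J by rewrite size_map size_iota.
  (* Independence is restricted to the row, where the density is given. *)
  apply: (independent_event_ge (D := range f)) => //.
  - by move=> K B' uK KD mB'; apply: indep => // i /KD[j _ <-].
  - by rewrite mulr_ge0 ?invr_ge0 ?exprn_ge0 ?ltW.
  - by rewrite map_inj_uniq ?iota_uniq.
  - by move=> i /mapP[j _ ->]; exists j.
  - move=> i [j _ <-]; exact: (density_mass_ge_powers (dens j) m1 x0m).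
have rowE w : E w -> 8 * v ^+ 2 <=
    \sum_(j < n) ((Num.sqrt n%:R)^-1 *
      truncate (trunc_level eps n) (X (f j) w)) ^+ 2.
  move=> Ew.
  rewrite [leRHS](bigID (fun j : 'I_n => (j < k)%N)) /=.
  apply: ler_wpDr; first by apply: sumr_ge0 => j _; rewrite sqr_ge0.
  (* Each of the first [k] entries contributes at least [m ^+ 2 / n], and
     [k * m ^+ 2 >= 8 * v ^+ 2 * n]. *)
  apply: (@le_trans _ _ (\sum_(j < n | (j < k)%N) m ^+ 2 / n%:R)).
    rewrite -(big_ord_widen n (fun=> m ^+ 2 / n%:R))// sumr_const card_ord.
    by rewrite -[leRHS]mulr_natl mulrA ler_pdivlMr// (lt_le_trans ltr01).
  apply: ler_sum => j jk.
  have : B (X (f j) w) by apply: Ew => /=; rewrite map_f// mem_iota.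
  rewrite /B /= in_itv/= => /andP[mX Xm].
  rewrite exprMn exprVn sqr_sqrtr ?ler0n// mulrC ler_pM2l ?invr_gt0//; last by lra.
  have X0 : 0 < X (f j) w by apply: lt_le_trans mX.
  rewrite /truncate gtr0_norm// ifT//.
  by apply: lerXn2r; rewrite ?nnegrE ?(ltW m0) ?(ltW X0).
rewrite MY.
have Y0 w : 0 <= Y n s w.
  by apply: le_trans (Yge _ _ _ n0); rewrite exprn_ge0// sumr_ge0// => j _; rewrite sqr_ge0.
have YE w : E w -> (8 * v ^+ 2) ^+ s <= Y n s w.
  move=> /rowE le8; apply: le_trans (Yge _ _ _ n0).
  by apply: lerXn2r; rewrite ?nnegrE// ?(le_trans _ le8)//; lra.
have EY := expectation_ge_event mE _ Y0 YE PE.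
apply: (@le_trans _ _ (((4 * v ^+ 2) ^+ s)^-1%:E *
    ((8 * v ^+ 2) ^+ s * (c * m ^- 13) ^+ k)%:E)%E).
  rewrite -EFinM lee_fin.
  have -> : 8 * v ^+ 2 = 2 * (4 * v ^+ 2) by ring.
  have : 4 * v ^+ 2 != 0 by rewrite gt_eqF// mulr_gt0.
  move: (4 * v ^+ 2) => a a0.
  rewrite exprMn (mulrC (2 ^+ s)) !mulrA mulVf ?mul1r ?expf_neq0//.
  by rewrite mulrC.
rewrite lee_wpmul2l ?lee_fin ?invr_ge0 ?exprn_ge0//; first lra.
by apply: EY; rewrite exprn_ge0//; lra.
Unshelve. all: by end_near. Qed.

End truncated_moments.

(** * The real symmetric and Hermitian ensembles *)

Section wigner.
Context {R : realType} {d : measure_display} {T : measurableType d}.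
Variable P : probability T R.

Lemma real_trunc_mx_sym v eps (a : nat -> nat -> {RV P >-> R}) n w :
  real_wigner_family v a -> (real_trunc_mx eps a n w)^T = real_trunc_mx eps a n w.
Proof.
case=> _ _ _ asym; apply/matrixP => i j; rewrite !mxE.
by have [ij|ji|->//] := ltngtP i j; [rewrite (asym _ _ ij)|rewrite -(asym _ _ ji)].
Qed.

Lemma herm_trunc_mx_herm eps (b : bool -> nat -> nat -> {RV P >-> R}) n w :
  hermitian_mx (herm_trunc_mx eps b n w).
Proof.
apply/matrixP => i j; rewrite !mxE rmorphM /= oppr0; congr (_ * _).
rewrite /herm_entry.
have [ij|ji|/val_inj ->] := ltngtP i j.
- by [].
- by rewrite conjcK.
- by rewrite /= oppr0.
Qed.

(** Row 0 lies on or above the diagonal, so no entry is read through its transpose. *)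
Lemma herm_trunc_mx_row0 eps (b : bool -> nat -> nat -> {RV P >-> R}) n w j :
  complex.Re (herm_trunc_mx eps b n.+1 w ord0 j) =
  (Num.sqrt n.+1%:R)^-1 * truncate (trunc_level eps n.+1) (b false 0%N j w).
Proof.
rewrite mxE /herm_entry /=; case: j => -[|j] jn /=; ring.
Qed.

End wigner.

Theorem theorem1 (R : realType) (phi : R -> R) (x0 : R)
  (phi_bounded : exists K : R, forall x, `|phi x| <= K)
  (phi_even : forall x, phi (- x) = phi x)
  (phi_pos : forall x, 0 < phi x)
  (phi_decr : forall x y, `|x| <= `|y| -> phi y <= phi x)
  (x0_ge1 : 1 <= x0)
  (phi_tail : forall x, x0 < x -> (ln x)^-1 <= phi x /\ phi x <= 1)
  (eps theta : R) (eps_gt0 : 0 < eps) (theta_gt0 : 0 < theta)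
  (d : measure_display) (T : measurableType d) (P : probability T R) (v : R) :
  (forall a : nat -> nat -> {RV P >-> R},
     real_wigner_family v a ->
     (forall i j, (i <= j)%N -> has_density (a i j) (tail_density phi)) ->
     normalized_limsup v (real_trunc_moment eps a) (moment_order theta)
       = +oo%E)
  /\
  (forall b : bool -> nat -> nat -> {RV P >-> R},
     herm_wigner_family v b ->
     (forall l i j, herm_index (l, i, j) ->
        has_density (b l i j) (tail_density phi)) ->
     normalized_limsup v (herm_trunc_moment eps b) (moment_order theta)
       = +oo%E).
Proof.
split=> [a wa da|b wb db].
- have [indep _ mom _] := wa.
  have v0 : v != 0.
    apply: (second_moment_neq0 phi_pos phi_decr (da _ _ (leqnn 0)) _ (mom _ _ (leqnn 0)).2).
    by move=> w; rewrite real_normK// num_real.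
  have row_inj : injective (fun j : nat => (0%N, j)) by move=> i j [].
  apply: (truncated_moments_diverge phi_pos phi_decr phi_tail indep row_inj _ _
    v0 eps_gt0 theta_gt0
    (Y := fun n s w => \tr (real_trunc_mx eps a n w ^+ (2 * s)))) => //.
  + by move=> j; exact: da.
  + move=> [//|n] s w _.
    apply: le_trans (symmetric_even_trace_ge s ord0 (real_trunc_mx_sym eps n.+1 w wa)).
    by under [in leRHS]eq_bigr do rewrite mxE.
- have [indep _ _ mom] := wb.
  have idx j : herm_index (false, 0%N, j).
    by case: j => [|j]; [right | left].
  (* The off-diagonal entry [(0, 1)] is used because the second moment is [v ^+ 2] only off the
     diagonal. *)
  have v0 : v != 0.
    apply: (second_moment_neq0 phi_pos phi_decr (db _ _ _ (idx 1%N)) _ (mom _ _ (ltn0Sn 0))).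
    move=> w; rewrite /herm_entry /= sqr_sqrtr ?addr_ge0 ?sqr_ge0//.
    by rewrite lerDl sqr_ge0.
  have row_inj : injective (fun j : nat => (false, 0%N, j)) by move=> i j [].
  apply: (truncated_moments_diverge phi_pos phi_decr phi_tail indep row_inj _ _
    v0 eps_gt0 theta_gt0
    (Y := fun n s w => complex.Re (\tr (herm_trunc_mx eps b n w ^+ (2 * s))))) => //.
  + by move=> j; exact: db.
  + move=> [//|n] s w _.
    apply: le_trans (hermitian_even_trace_ge s ord0 (herm_trunc_mx_herm eps b n.+1 w)).
    by under [in leRHS]eq_bigr do rewrite herm_trunc_mx_row0.
Qed.
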